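(* Let $\phi:\mathbb{R}^d\to\mathbb{R}$ be a convex quadratic function with Hessian $A\in\mathbb{R}^{d\times d}$, i.e. $\phi(\mathbf{y})=\phi(\mathbf{x})+\langle\nabla\phi(\mathbf{x}),\mathbf{y}-\mathbf{x}\rangle+\frac12\|\mathbf{y}-\mathbf{x}\|_A^2$ for all $\mathbf{x},\mathbf{y}$, with $0\preceq A\preceq L\cdot I$, $L>0$. Let $f=\phi+\zeta$ with $|f(\mathbf{x})-\phi(\mathbf{x})|\le\sigma$ for all $\mathbf{x}\in\mathbb{R}^d$, $\sigma\ge0$. Let $S\in\mathbb{R}^{d\times\ell}$ be a given matrix with columns $\mathbf{s}^{(1)},\dots,\mathbf{s}^{(\ell)}$, let $\alpha>0$, and define $$\mathbf{g}(\mathbf{x})=\sum_{i=1}^{\ell}\frac{f(\mathbf{x}+\alpha\mathbf{s}^{(i)})-f(\mathbf{x}-\alpha\mathbf{s}^{(i)})}{2\alpha}\,\mathbf{s}^{(i)}.$$ Then $$\mathbf{g}(\mathbf{x})=SS^\top\nabla\phi(\mathbf{x})+S\mathbf{v}\quad\text{and}\quad\|\mathbf{v}\|^2\le\frac{\ell\sigma^2}{\alpha^2},$$ where $\mathbf{v}\in\mathbb{R}^\ell$ has $i$-th entry $v^{(i)}=\frac{\zeta(\mathbf{x}+\alpha\mathbf{s}^{(i)})-\zeta(\mathbf{x}-\alpha\mathbf{s}^{(i)})}{2\alpha}$.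
   Context: $\|\cdot\|$ is the Euclidean norm; $\|\mathbf{x}\|_A=\|A^{1/2}\mathbf{x}\|$; $B\preceq C$ means $C-B$ is positive semidefinite. *)

(* Defs.v *)
From HB Require Import structures.
From mathcomp Require Import all_boot all_order all_algebra.
From mathcomp Require Import all_classical all_reals all_analysis.

Set Implicit Arguments.
Unset Strict Implicit.
Unset Printing Implicit Defensive.

Import Order.TTheory GRing.Theory Num.Theory.
Import numFieldNormedType.Exports.

Local Open Scope classical_set_scope.
Local Open Scope ring_scope.

Section Definitions.
Context {R : realType}.

Definition edot (d : nat) (u v : 'cV[R]_d) : R := \sum_i u i 0 * v i 0.

(* The canonical norm [`|u|] on matrices is the sup norm, hence a separate
   Euclidean norm. *)
Definition enorm (d : nat) (u : 'cV[R]_d) : R := Num.sqrt (edot u u).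

Definition psdmx (d : nat) (A : 'M[R]_d) : Prop :=
  A^T = A /\ forall x : 'cV[R]_d, 0 <= edot x (A *m x).

Definition loewner_le (d : nat) (B C : 'M[R]_d) : Prop := psdmx (C - B).

(* A^{1/2}: a positive semidefinite matrix has exactly one positive
   semidefinite square root; the default value 0 is only used when [A] is not
   positive semidefinite. *)
Definition sqrtmx (d : nat) (A : 'M[R]_d) : 'M[R]_d :=
  xget 0 [set B : 'M[R]_d | psdmx B /\ B *m B = A].

Definition anorm (d : nat) (A : 'M[R]_d) (u : 'cV[R]_d) : R :=
  enorm (sqrtmx A *m u).

Definition grad (d : nat) (phi : 'cV[R]_d -> R) (x : 'cV[R]_d) : 'cV[R]_d :=
  \col_i 'D_(delta_mx i 0) phi x.

(* No separate differentiability assumption is needed: the expansion at [x]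
   for every [y] forces [phi] to be differentiable at [x], so that
   [grad phi x] is its genuine gradient. *)
Definition quadratic_with_hessian (d : nat) (A : 'M[R]_d)
    (phi : 'cV[R]_d -> R) : Prop :=
  forall x y : 'cV[R]_d,
    phi y = phi x + edot (grad phi x) (y - x) + 2^-1 * anorm A (y - x) ^+ 2.

Definition central_diff (d : nat) (h : 'cV[R]_d -> R) (alpha : R)
    (x s : 'cV[R]_d) : R :=
  (h (x + alpha *: s) - h (x - alpha *: s)) / (2 * alpha).

Definition grad_est (d l : nat) (f : 'cV[R]_d -> R) (S : 'M[R]_(d, l))
    (alpha : R) (x : 'cV[R]_d) : 'cV[R]_d :=
  \sum_(i < l) central_diff f alpha x (col i S) *: col i S.

Definition noise_vec (d l : nat) (zeta : 'cV[R]_d -> R) (S : 'M[R]_(d, l))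
    (alpha : R) (x : 'cV[R]_d) : 'cV[R]_l :=
  \col_(i < l) central_diff zeta alpha x (col i S).

End Definitions.

(* Main.v *)
Require Import Defs.
From mathcomp Require Import all_boot all_order all_algebra.
From mathcomp Require Import all_classical all_reals all_analysis.
From mathcomp Require Import ring.

Import Order.TTheory GRing.Theory Num.Theory.
Import numFieldNormedType.Exports.

Local Open Scope classical_set_scope.
Local Open Scope ring_scope.

(** The second-order term of the expansion of [phi] around [x] is even in the
    displacement, so it takes the same value at [alpha *: s] and at
    [- alpha *: s] and cancels in the central difference.  On a quadratic the
    central difference along [s] is therefore the exact directional derivative
    [edot (grad phi x) s] ([central_diff_quadratic]), not merely an
    approximation of it.  Summing these, weighted by the columns of [S], gives
    [S *m S^T *m grad phi x].

    Central differences are additive in the function, so the noise adds the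
    vector [noise_vec] of its own central differences, carried to the estimator
    by the linear map [S].  Two values of a function bounded by [sigma] differ
    by at most [2 * sigma]; after division by [2 * alpha] each entry of this
    vector is at most [sigma / alpha] in absolute value
    ([central_diff_bounded]), and there are [l] squared entries to sum. *)

Lemma edotZr (R : realType) (d : nat) (a : R) (u v : 'cV[R]_d) :
  edot u (a *: v) = a * edot u v.
Proof.
by rewrite /edot mulr_sumr; apply: eq_bigr => i _; rewrite mxE mulrCA.
Qed.

Lemma edotNr (R : realType) (d : nat) (u v : 'cV[R]_d) :
  edot u (- v) = - edot u v.
Proof. by rewrite -scaleN1r edotZr mulN1r. Qed.

Lemma edot_ge0 (R : realType) (d : nat) (u : 'cV[R]_d) : 0 <= edot u u.
Proof. by apply: sumr_ge0 => i _; rewrite -expr2 sqr_ge0. Qed.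

Lemma sqr_enorm (R : realType) (d : nat) (u : 'cV[R]_d) :
  enorm u ^+ 2 = edot u u.
Proof. by rewrite /enorm sqr_sqrtr // edot_ge0. Qed.

Lemma anormN (R : realType) (d : nat) (A : 'M[R]_d) (u : 'cV[R]_d) :
  anorm A (- u) = anorm A u.
Proof.
rewrite /anorm /enorm mulmxN; congr Num.sqrt.
by apply: eq_bigr => i _; rewrite mxE mulrNN.
Qed.

Lemma sqr_enorm_le (R : realType) (d : nat) (u : 'cV[R]_d) (c : R) :
  (forall i, `|u i 0| <= c) -> enorm u ^+ 2 <= d%:R * c ^+ 2.
Proof.
move=> u_le; rewrite sqr_enorm /edot.
rewrite -[d in d%:R]card_ord mulr_natl -sumr_const.
apply: ler_sum => i _.
by rewrite -expr2 -real_normK ?num_real// lerXn2r ?nnegrE ?(le_trans _ (u_le i)).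
Qed.

Lemma central_diffD (R : realType) (d : nat) (f g h : 'cV[R]_d -> R)
    (alpha : R) (x s : 'cV[R]_d) :
  (forall y, f y = g y + h y) ->
  central_diff f alpha x s = central_diff g alpha x s + central_diff h alpha x s.
Proof. by move=> fE; rewrite /central_diff !fE -mulrDl opprD addrACA. Qed.

(** Only the first-order term of the expansion is odd in the displacement, and
    the central difference keeps exactly the odd part. *)
Lemma central_diff_quadratic (R : realType) (d : nat) (A : 'M[R]_d)
    (phi : 'cV[R]_d -> R) (alpha : R) (x s : 'cV[R]_d) :
  quadratic_with_hessian A phi -> alpha != 0 ->
  central_diff phi alpha x s = edot (grad phi x) s.
Proof.
move=> phi_quad alpha_neq0; rewrite /central_diff.
rewrite (phi_quad x (x + _)) (phi_quad x (x - _)).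
rewrite ![x + _ - x]addrAC subrr !add0r anormN edotNr edotZr.
by field.
Qed.

Lemma central_diff_bounded (R : realType) (d : nat) (h : 'cV[R]_d -> R)
    (alpha sigma : R) (x s : 'cV[R]_d) :
  0 < alpha -> (forall y, `|h y| <= sigma) ->
  `|central_diff h alpha x s| <= sigma / alpha.
Proof.
move=> alpha_gt0 h_le; have two_alpha_gt0 : 0 < 2 * alpha by rewrite mulr_gt0.
rewrite /central_diff normrM normfV (gtr0_norm two_alpha_gt0) ler_pdivrMr //.
have -> : sigma / alpha * (2 * alpha) = sigma + sigma.
  by field; rewrite gt_eqF.
by rewrite (le_trans (ler_normB _ _)) // lerD.
Qed.

Lemma mulmx_sum_col (R : realType) (d l : nat) (S : 'M[R]_(d, l))
    (v : 'cV[R]_l) :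
  S *m v = \sum_(i < l) v i 0 *: col i S.
Proof.
apply/matrixP => j k; rewrite mxE summxE ord1.
by apply: eq_bigr => i _; rewrite !mxE mulrC.
Qed.

Lemma trmx_mul_edot (R : realType) (d l : nat) (S : 'M[R]_(d, l))
    (u : 'cV[R]_d) (i : 'I_l) :
  (S^T *m u) i 0 = edot u (col i S).
Proof. by rewrite mxE; apply: eq_bigr => j _; rewrite !mxE mulrC. Qed.

Theorem lemma1 (R : realType) (d l : nat)
    (A : 'M[R]_d) (L : R) (phi zeta f : 'cV[R]_d -> R) (sigma : R)
    (S : 'M[R]_(d, l)) (alpha : R)
    (phi_convex : convex_function [set: convex_lmodType 'cV[R]_d] phi)
    (phi_quad : quadratic_with_hessian A phi)
    (L_gt0 : 0 < L)
    (A_ge0 : loewner_le 0 A)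
    (A_leL : loewner_le A (L *: 1%:M))
    (sigma_ge0 : 0 <= sigma)
    (f_def : forall x : 'cV[R]_d, f x = phi x + zeta x)
    (f_noise : forall x : 'cV[R]_d, `|f x - phi x| <= sigma)
    (alpha_gt0 : 0 < alpha) (x : 'cV[R]_d) :
  grad_est f S alpha x
    = S *m S^T *m grad phi x + S *m noise_vec zeta S alpha x
  /\ enorm (noise_vec zeta S alpha x) ^+ 2
       <= l%:R * sigma ^+ 2 / alpha ^+ 2.
Proof.
split.
  rewrite -mulmxA -mulmxDr mulmx_sum_col; apply: eq_bigr => i _.
  rewrite [in RHS]mxE trmx_mul_edot [in RHS]mxE.
  rewrite (central_diffD _ _ _ _ _ _ _ _ f_def).
  by rewrite (central_diff_quadratic _ _ _ _ _ _ _ phi_quad) // gt_eqF.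
have zeta_le y : `|zeta y| <= sigma.
  by have := f_noise y; rewrite f_def addrAC subrr add0r.
rewrite -mulrA -expr_div_n; apply: sqr_enorm_le => i.
by rewrite mxE central_diff_bounded.
Qed.
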